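(* Let $m\ge1$, $n\ge1$, $N>2n$. A nonsingular $mN\times mN$ matrix $\boldsymbol\Sigma_N$ is the covariance matrix of a reciprocal process of order $n$ on $\mathbb Z_N$ if and only if $\boldsymbol\Sigma_N^{-1}$ is a positive definite symmetric block-circulant matrix which is banded of bandwidth $n$.
   Context: A matrix with $N\times N$ blocks of size $m\times m$ is block-circulant if its $(i,j)$ block depends only on $(i-j)\bmod N$, and banded of bandwidth $n$ if its $(i,j)$ block is zero whenever $\min\{(i-j)\bmod N,(j-i)\bmod N\}>n$. A process on $\mathbb Z_N$ is a zero-mean second-order $\mathbb R^m$-valued process $\{\mathbf y(t)\}_{t=1}^N$ (indices mod $N$) whose covariance $\mathbb E\,\mathbf y\mathbf y^\top$ is symmetric block-circulant (i.e. it is stationary on the discrete circle). $\hat{\mathbb E}[\cdot\mid\cdot]$ is orthogonal projection onto the closed linear span of the scalar components of the conditioning variables. Subspaces $\mathcal A,\mathcal B$ are conditionally orthogonal given $\mathcal C$ if $a-\hat{\mathbb E}[a\mid\mathcal C]$ and $b-\hat{\mathbb E}[b\mid\mathcal C]$ are uncorrelated for all $a\in\mathcal A,b\in\mathcal B$. The process is reciprocal of order $n$ if for every cyclic interval $(t_1,t_2)$ the variables $\{\mathbf y(t):t\in(t_1,t_2)\}$ are conditionally orthogonal to $\{\mathbf y(s):s\notin(t_1,t_2)\}$ given $\mathbf y(t_1-n+1),\dots,\mathbf y(t_1),\mathbf y(t_2),\dots,\mathbf y(t_2+n-1)$. *)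

(* Defs.v *)
From HB Require Import structures.
From mathcomp Require Import all_boot all_order all_algebra.
From mathcomp Require Import all_classical all_reals all_analysis.
Set Implicit Arguments. Unset Strict Implicit. Unset Printing Implicit Defensive.
Import Order.TTheory GRing.Theory Num.Theory.
Local Open Scope ring_scope.
Local Open Scope ereal_scope.
Local Open Scope ring_scope.

(* entry (a,b) of block (t,s) of M; global index of (t,a) is t*m + a *)
Definition blk (R : Type) (N m : nat) (M : 'M[R]_(N * m)) (t s : 'I_N) (a b : 'I_m) : R :=
  M (mxvec_index t a) (mxvec_index s b).

Definition cdiff (N : nat) (t s : 'I_N) : nat := ((t + N - s) %% N)%N.

Definition block_circulant (R : Type) (N m : nat) (M : 'M[R]_(N * m)) : Prop :=
  forall t s t' s' : 'I_N, cdiff t s = cdiff t' s' -> forall a b : 'I_m,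
    blk M t s a b = blk M t' s' a b.

Definition banded (R : pzRingType) (N m n : nat) (M : 'M[R]_(N * m)) : Prop :=
  forall t s : 'I_N, (n < minn (cdiff t s) (cdiff s t))%N ->
    forall a b : 'I_m, blk M t s a b = 0.


Definition posdefmx (R : numDomainType) (k : nat) (M : 'M[R]_k) : Prop :=
  forall v : 'rV[R]_k, v != 0 -> 0 < (v *m M *m v^T) 0 0.

Section Process.
Context {d : measure_display} {T : measurableType d} {R : realType}.
Variable (P : probability T R) (N m : nat).
Implicit Type (y : 'I_N -> 'I_m -> T -> R).

Definition ip (X Y : T -> R) : R := fine ('E_P[X * Y])%E.

Definition is_covariance y (S : 'M[R]_(N * m)) : Prop :=
  forall (t s : 'I_N) (a b : 'I_m), ('E_P[y t a * y s b])%E = (blk S t s a b)%:E.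

Definition ZN_process y (S : 'M[R]_(N * m)) : Prop :=
  [/\ forall t a, y t a \in Lfun P 2%:E,
      forall t a, ('E_P[y t a])%E = 0%E,
      is_covariance y S,
      S \is symmetricmx & block_circulant S].

Definition in_span y (A : pred 'I_N) (X : T -> R) : Prop :=
  exists c : 'I_N -> 'I_m -> R, (forall t a, ~~ A t -> c t a = 0) /\
    X = (fun w => \sum_(t < N) \sum_(a < m) c t a * y t a w).

Definition is_proj y (C : pred 'I_N) (X p : T -> R) : Prop :=
  in_span y C p /\ forall t a, C t -> ip (X - p) (y t a) = 0.

Definition cond_orth y (A B C : pred 'I_N) : Prop :=
  forall a b pa pb : T -> R, in_span y A a -> in_span y B b ->
    is_proj y C a pa -> is_proj y C b pb -> ip (a - pa) (b - pb) = 0.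

Definition cyc_interval (t1 t2 : 'I_N) : pred 'I_N :=
  fun s => (0 < cdiff s t1)%N && (cdiff s t1 < cdiff t2 t1)%N.

(* boundary {t1-n+1,...,t1} u {t2,...,t2+n-1} mod N *)
Definition cyc_boundary (n : nat) (t1 t2 : 'I_N) : pred 'I_N :=
  fun s => (cdiff t1 s < n)%N || (cdiff s t2 < n)%N.

Definition reciprocal (n : nat) y : Prop :=
  forall t1 t2 : 'I_N,
    cond_orth y (cyc_interval t1 t2) (fun s => ~~ cyc_interval t1 t2 s)
      (cyc_boundary n t1 t2).

End Process.

(* Main.v *)
Require Import Defs.
From HB Require Import structures.
From mathcomp Require Import all_boot all_order all_algebra.
From mathcomp Require Import all_classical all_reals all_analysis.
From mathcomp Require Import ring lra zify.
Import Order.TTheory GRing.Theory Num.Theory.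
Local Open Scope ring_scope.
Set Implicit Arguments. Unset Strict Implicit. Unset Printing Implicit Defensive.

(* Let [K] be the inverse covariance.  Writing a linear combination of the
   process with coefficients [x *m K], its correlations with the variables are the
   entries of [x]; hence a set of times [A] and its complement are conditionally
   orthogonal given [C] iff [K] has no nonzero entry between [A] minus [C] and the
   complement of [A] minus [C].  A time inside an interval and a time outside both
   the interval and its boundary are more than [n] apart, and conversely two times
   at distance more than [n] are separated by the singleton interval around one of
   them; so reciprocity of order [n] says exactly that [K] is banded.
   Existence of the process: factor the covariance as [L *m L^T] and transform
   uncorrelated variables on a finite uniform probability space. *)

(** * Positive definite matrices *)

Lemma symmetricmxP (R : fieldType) (k : nat) (M : 'M[R]_k) :
  M \is symmetricmx <-> M^T = M.
Proof.
rewrite is_hermitianmxE expr0 scale1r map_mx_id //.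
by split=> [/eqP/esym|->].
Qed.

Section PosDef.
Context {R : realFieldType} {k : nat}.
Implicit Types (M : 'M[R]_k) (u v w x z : 'rV[R]_k) (D A C : pred 'I_k).

Definition restr D v : 'rV[R]_k := \row_j (if D j then v 0 j else 0).

Lemma dotE u v : (u *m v^T) 0 0 = \sum_j u 0 j * v 0 j.
Proof. by rewrite mxE; apply: eq_bigr => j _; rewrite mxE. Qed.

Lemma dot_self_eq0 u : (u *m u^T) 0 0 = 0 -> u = 0.
Proof.
rewrite dotE => /eqP; rewrite psumr_eq0; last by move=> j _; rewrite -expr2 sqr_ge0.
move=> /allP u0; apply/rowP => j; rewrite mxE.
by have := u0 j (mem_index_enum _); rewrite mulf_eq0 orbb => /eqP.
Qed.

Lemma posdefmx_eq0 M v : posdefmx M -> (v *m M *m v^T) 0 0 = 0 -> v = 0.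
Proof.
move=> pM q0; apply/eqP; apply/negPn/negP => /pM; by rewrite q0 ltxx.
Qed.

Lemma unitmx_ker0 M : (forall v, v *m M = 0 -> v = 0) -> M \in unitmx.
Proof.
move=> inj; rewrite -row_free_unit -kermx_eq0; apply/eqP/row_matrixP => i.
by rewrite row0; apply: inj; rewrite -row_mul mulmx_ker row0.
Qed.

Lemma posdefmx_unit M : posdefmx M -> M \in unitmx.
Proof.
move=> pM; apply: unitmx_ker0 => v v0; apply: (posdefmx_eq0 pM).
by rewrite v0 mul0mx mxE.
Qed.

Lemma posdefmx_inv M : M^T = M -> posdefmx M -> posdefmx (invmx M).
Proof.
move=> sM pM v v0; have uM := posdefmx_unit pM.
set w := v *m invmx M; have vE : v = w *m M by rewrite mulmxKV.
rewrite {1}vE trmx_mul sM mulmxA; apply: pM.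
by apply: contraNneq v0 => w0; rewrite vE w0 mul0mx.
Qed.

Lemma trmx_invmx M : M^T = M -> (invmx M)^T = invmx M.
Proof. by move=> sM; rewrite trmx_inv sM. Qed.

(** If the form vanishes at [v] and [w = v *m M], its value at [s *: v + w] is affine in [s] with
    slope twice the squared norm of [w]. Nonnegativity forces [w = 0], and invertibility gives
    [v = 0]. *)
Lemma semiposdef_posdefmx M : M^T = M -> M \in unitmx ->
  (forall v, 0 <= (v *m M *m v^T) 0 0) -> posdefmx M.
Proof.
move=> sM uM psd v v0; rewrite lt_neqAle psd andbT; apply/eqP => q0.
case/negP: v0; apply/eqP; set w := v *m M.
suff /dot_self_eq0 w0 : (w *m w^T) 0 0 = 0 by rewrite -(mulmxK uM v) -/w w0 mul0mx.
have sq s : 0 <= (w *m w^T) 0 0 * s *+ 2 + (w *m M *m w^T) 0 0.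
  have := psd (s *: v + w).
  rewrite linearD /= !linearZ /= !mulmxDl !mulmxDr -!scalemxAl -!scalemxAr.
  have -> : w *m M *m v^T = w *m w^T by rewrite trmx_mul sM mulmxA.
  rewrite -/w; have -> : v *m M *m v^T = 0 by apply/matrixP => i j; rewrite !ord1 -q0 mxE.
  by rewrite !scaler0 add0r !mxE; lra.
apply/eqP/negPn/negP => b0; set b := (w *m w^T) 0 0 in sq b0.
set c := (w *m M *m w^T) 0 0 in sq.
(* At this [s] the affine function takes the value -1. *)
have := sq (- (c + 1) / (2 * b)).
have -> : b * (- (c + 1) / (2 * b)) *+ 2 + c = -1 by rewrite mulr2n; field.
lra.
Qed.

Lemma bilin_sym M x z : M^T = M -> x *m M *m z^T = x *m (z *m M)^T.
Proof. by move=> sM; rewrite trmx_mul sM mulmxA. Qed.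

(* The solution is read off the invertible matrix that agrees with [M] on the
   rows and columns of [D] and with the identity elsewhere. *)
Lemma posdefmx_solve M D w : posdefmx M -> exists x,
  (forall i, ~~ D i -> x 0 i = 0) /\ (forall i, D i -> (x *m M) 0 i = w 0 i).
Proof.
move=> pM; pose r v := restr D v; pose P := diag_mx (r (const_mx 1)).
have rP v : v *m P = r v.
  apply/rowP => j; rewrite mul_mx_diag !mxE; case: ifP; by rewrite ?mulr1 ?mulr0.
pose M' := P *m M *m P + (1%:M - P).
have M'E v : v *m M' = r (r v *m M) + (v - r v).
  by rewrite mulmxDr mulmxBr mulmx1 !mulmxA !rP.
have uM' : M' \in unitmx.
  apply: unitmx_ker0 => v; rewrite M'E => /rowP v0.
  have voff i : ~~ D i -> v 0 i = 0.
    by move=> /negbTE Di; have := v0 i; rewrite !mxE Di subr0 add0r.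
  have rv : r v = v by apply/rowP => i; rewrite mxE; case: ifPn => // /voff.
  apply: (posdefmx_eq0 pM); rewrite dotE big1 // => i _.
  have := v0 i; rewrite rv subrr addr0 !mxE; case: ifPn => Di; last by rewrite voff // mulr0.
  by move=> ->; rewrite mul0r.
exists (r w *m invmx M').
set x := _ *m invmx M'; have /rowP xE : r (r x *m M) + (x - r x) = r w.
  by rewrite -M'E mulmxKV.
have xoff i : ~~ D i -> x 0 i = 0.
  by move=> /negbTE Di; have := xE i; rewrite !mxE Di subr0 add0r.
split=> // i Di.
have rx : r x = x by apply/rowP => l; rewrite mxE; case: ifPn => // /xoff.
by have := xE i; rewrite rx subrr addr0 !mxE Di.
Qed.

(** Off [A] and [C], the equations for [x] involve only the part of [x] living there, as the cross
    entries of [M] vanish; positive definiteness makes that part zero. The form is the dot product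
    of [x] with [z *m M], and at every index one factor is now zero. *)
Lemma cross_zero_orth M A C x z : M^T = M -> posdefmx M ->
  (forall i j, A i -> ~~ C i -> ~~ A j -> ~~ C j -> M i j = 0) ->
  (forall i, C i -> x 0 i = 0) ->
  (forall j, ~~ A j -> ~~ C j -> (x *m M) 0 j = 0) ->
  (forall i, A i -> ~~ C i -> (z *m M) 0 i = 0) ->
  (x *m M *m z^T) 0 0 = 0.
Proof.
move=> sM pM cross xC xB zA.
pose B j := ~~ A j && ~~ C j.
have B0 : restr B x = 0.
  apply: (posdefmx_eq0 pM); rewrite dotE big1 // => j _.
  rewrite [X in _ * X]mxE; case: ifPn => [|_]; last by rewrite mulr0.
  move=> /andP[Aj Cj]; suff -> : (restr B x *m M) 0 j = 0 by rewrite mul0r.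
  rewrite -[RHS](xB j) // !mxE; apply: eq_bigr => i _; rewrite mxE /B.
  have [Ci|Ci] := boolP (C i); first by rewrite andbF xC.
  by have [Ai|] //= := boolP (A i); rewrite cross ?mulr0.
rewrite bilin_sym // dotE big1 // => j _.
have [Cj|Cj] := boolP (C j); first by rewrite xC // mul0r.
have [Aj|Aj] := boolP (A j); first by rewrite zA // mulr0.
by have /rowP/(_ j) := B0; rewrite !mxE /B Aj Cj /= => ->; rewrite mul0r.
Qed.

(** A vector [x] is built to satisfy the support conditions and then shown to be the basis vector at
    [i]; the vanishing of [x *m M] at [j] becomes the claim. *)
Lemma orth_cross_zero M A C : M^T = M -> posdefmx M ->
  (forall x z, (forall i, C i -> x 0 i = 0) -> (forall i, C i -> z 0 i = 0) ->
    (forall j, ~~ A j -> ~~ C j -> (x *m M) 0 j = 0) ->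
    (forall i, A i -> ~~ C i -> (z *m M) 0 i = 0) ->
    (x *m M *m z^T) 0 0 = 0) ->
  forall i j, A i -> ~~ C i -> ~~ A j -> ~~ C j -> M i j = 0.
Proof.
move=> sM pM orth i j Ai Ci Aj Cj.
have [x [xC xE]] := posdefmx_solve (predC C) (restr A (row i M)) pM.
have {}xC l : C l -> x 0 l = 0 by move=> Cl; rewrite xC //= negbK.
have xB l : ~~ A l -> ~~ C l -> x 0 l = 0.
  (* Off [C], [z *m M] is the basis vector at [l], so the form at [x] and [z] extracts the
     coordinate [x 0 l]. *)
  move=> Al Cl; have [z [zC zE]] := posdefmx_solve (predC C) (delta_mx 0 l) pM.
  have {}zC h : C h -> z 0 h = 0 by move=> Ch; rewrite zC //= negbK.
  have := orth x z xC zC; rewrite bilin_sym // dotE.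
  rewrite (bigD1 l) //= big1 => [|h hl]; last first.
    have [Ch|Ch] := boolP (C h); first by rewrite xC ?mul0r.
    by rewrite zE // mxE (negbTE hl) andbF mulr0.
  rewrite addr0 zE // mxE !eqxx mulr1; apply=> h Ah Ch.
    by rewrite xE // mxE (negbTE Ah).
  rewrite zE // mxE; case: (eqVneq h l) => [hl|_]; rewrite ?andbF //.
  by rewrite -hl Ah in Al.
(* The difference is supported on [A] minus [C], where its product with [M] vanishes, so its
   quadratic form is zero. *)
have xi : x = delta_mx 0 i.
  apply/eqP; rewrite -subr_eq0; apply/eqP/(posdefmx_eq0 pM).
  rewrite dotE big1 // => l _.
  have [Cl|Cl] := boolP (C l).
    rewrite [X in _ * X]mxE xC // !mxE (_ : l == i = false) ?andbF ?subr0 ?mulr0 //.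
    by apply: contraTF Cl => /eqP ->.
  have [Al|Al] := boolP (A l); last first.
    rewrite [X in _ * X]mxE xB // !mxE (_ : l == i = false) ?andbF ?subr0 ?mulr0 //.
    by apply: contraNF Al => /eqP ->.
  by rewrite mulmxBl -rowE [X in X * _]mxE xE // !mxE Al subrr mul0r.
by have := xE j Cj; rewrite xi -rowE !mxE (negbTE Aj).
Qed.

End PosDef.

(** Induction on the size: the Schur complement [S] of the top left entry is again symmetric and
    positive definite. *)
Lemma posdefmx_cholesky (R : rcfType) (k : nat) (M : 'M[R]_k) :
  M^T = M -> posdefmx M -> exists L : 'M[R]_k, M = L *m L^T.
Proof.
elim: k M => [|k IH] M sM pM; first by exists 0; apply/matrixP => - [].
pose M1 : 'M[R]_(1 + k) := M; pose a := M1 0 0; pose c := ursubmx M1.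
have a0 : 0 < a.
  have := pM (delta_mx 0 0); rewrite -rowE trmx_delta -colE !mxE; apply.
  by apply/eqP => /rowP/(_ 0); rewrite !mxE !eqxx /=; apply/eqP; rewrite oner_eq0.
have ulE : ulsubmx M1 = a%:M.
  apply/matrixP => i j; rewrite !ord1 !mxE eqxx mulr1n /a.
  by congr (M _ _); apply: val_inj.
have sM1 : M1^T = M1 := sM.
have dlE : dlsubmx M1 = c^T by rewrite -{1}sM1 -trmx_ursub.
have drS : (drsubmx M1)^T = drsubmx M1 by rewrite trmx_drsub sM1.
have ME : M1 = block_mx a%:M c c^T (drsubmx M1) by rewrite -ulE -dlE submxK.
pose S := drsubmx M1 - a^-1 *: (c^T *m c).
have [|v v0|L LE] := IH S.
- by rewrite linearB linearZ /= trmx_mul trmxK drS.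
(* The first coordinate completes the square, so that the form of [M1] at [w] is the form of [S] at
   [v]. *)
- pose w : 'rV[R]_(1 + k) := row_mx (- a^-1 *: (v *m c^T)) v.
  suff -> : v *m S *m v^T = w *m M1 *m w^T.
    apply: pM; apply: contraNneq v0 => w0; apply/eqP.
    by rewrite -[v](row_mxKr (- a^-1 *: (v *m c^T))) -/w w0 linear0.
  rewrite [in RHS]ME /w mul_row_block tr_row_mx mul_row_col.
  rewrite mul_mx_scalar scalerA mulrN divff ?gt_eqF // scaleN1r addNr mul0mx add0r.
  by rewrite /S mulmxBr -scalemxAr -!scalemxAl scaleNr addrC mulmxA.
pose L1 : 'M[R]_(1 + k) := block_mx (Num.sqrt a)%:M 0 ((Num.sqrt a)^-1 *: c^T) L.
exists L1; suff : M1 = L1 *m L1^T by [].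
have s0 : Num.sqrt a != 0 by rewrite gt_eqF ?sqrtr_gt0.
rewrite [LHS]ME /L1 tr_block_mx mulmx_block !trmx0 !mul0mx !mulmx0 !addr0.
rewrite tr_scalar_mx -scalar_mxM -expr2 sqr_sqrtr ?ltW // linearZ /= trmxK.
rewrite mul_scalar_mx mul_mx_scalar !scalerA.
rewrite (mulfV s0) !scale1r.
rewrite -LE -scalemxAl -scalemxAr scalerA -expr2 exprVn sqr_sqrtr ?ltW //.
by rewrite /S addrC subrK.
Qed.

(** * Block indices *)

Lemma sum_mxvec (V : nmodType) (N m : nat) (F : 'I_(N * m) -> V) :
  \sum_i F i = \sum_(t < N) \sum_(a < m) F (mxvec_index t a).
Proof.
by rewrite pair_bigA (reindex _ (curry_mxvec_bij N m)); apply: eq_bigr => -[].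
Qed.

(** Inverts the time component of [mxvec_index], so that sets of times pull back to sets of scalar
    indices. *)
Definition block_idx (N m : nat) (i : 'I_(N * m)) : 'I_N :=
  (enum_val (cast_ord (esym (mxvec_cast N m)) i)).1.

Lemma block_idxE (N m : nat) (t : 'I_N) (a : 'I_m) :
  block_idx (mxvec_index t a) = t.
Proof. by rewrite /block_idx /mxvec_index cast_ordK enum_rankK. Qed.

(** * Linear combinations of the process and conditional orthogonality *)

Section Expectation.
Context {d : measure_display} {T : measurableType d} {R : realType}.
Variable P : probability T R.

Lemma Lfun1_sum (I : Type) (r : seq I) (F : I -> T -> R) :
  (forall i, F i \in Lfun P 1) -> (fun w => \sum_(i <- r) F i w) \in Lfun P 1.
Proof.
move=> F1; rewrite (_ : (fun w => _) = \sum_(i <- r) F i).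
  by apply: rpred_sum => i _; exact: F1.
by apply/funext => w; rewrite fct_sumE.
Qed.

Lemma expectation_bigsum (I : Type) (r : seq I) (F : I -> T -> R) :
  (forall i, F i \in Lfun P 1) ->
  expectation P (fun w => \sum_(i <- r) F i w) =
  (\sum_(i <- r) expectation P (F i))%E.
Proof.
move=> F1; elim: r => [|i r IH].
  rewrite big_nil -[RHS](expectation_cst P 0); congr expectation.
  by apply/funext => w; rewrite big_nil.
rewrite big_cons -IH -expectationD //; last exact: Lfun1_sum.
by congr expectation; apply/funext => w; rewrite big_cons.
Qed.

Context {N m : nat}.
Variables (y : 'I_N -> 'I_m -> T -> R) (S : 'M[R]_(N * m)).
Implicit Types (u v x z : 'rV[R]_(N * m)) (A C : pred 'I_N).

Definition lincomb u : T -> R :=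
  fun w => \sum_(t < N) \sum_(a < m) u 0 (mxvec_index t a) * y t a w.

Lemma lincombB u v : lincomb u - lincomb v = lincomb (u - v).
Proof.
apply/funext => w; rewrite !fctE /lincomb -sumrB; apply: eq_bigr => t _.
by rewrite -sumrB; apply: eq_bigr => a _; rewrite !mxE mulrBl.
Qed.

Lemma lincomb_delta t a : lincomb (delta_mx 0 (mxvec_index t a)) = y t a.
Proof.
apply/funext => w; rewrite /lincomb (bigD1 t) //= (bigD1 a) //= mxE !eqxx mul1r.
rewrite big1 ?addr0 => [|b ba]; first rewrite big1 ?addr0 // => s st.
  rewrite big1 // => b _; rewrite mxE eqxx /=; case: eqP => [/(congr1 (@block_idx _ _))|_].
    by rewrite !block_idxE => /eqP; rewrite (negbTE st).
  by rewrite mul0r.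
have inj := bij_inj (onT_bij (curry_mxvec_bij N m)).
rewrite mxE eqxx /=; case: eqP => [e|_].
  by case: (inj (t, b) (t, a) e) => /eqP; rewrite (negbTE ba).
by rewrite mul0r.
Qed.

Lemma in_spanP A X : in_span y A X <->
  exists2 u : 'rV[R]_(N * m), (forall i, ~~ A (block_idx i) -> u 0 i = 0) & X = lincomb u.
Proof.
split=> [[c [cA ->]]|[u uA ->]].
  exists (mxvec (\matrix_(t, a) c t a)).
    by move=> i; case/mxvec_indexP: i => t a; rewrite block_idxE mxvecE mxE => /cA.
  by apply/funext => w; apply: eq_bigr => t _; apply: eq_bigr => a _; rewrite mxvecE mxE.
exists (fun t a => u 0 (mxvec_index t a)); split=> // t a At.
by rewrite uA // block_idxE.
Qed.

Hypothesis yS : ZN_process P y S.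

(** Square integrability makes all products integrable, so the expectation passes through the finite
    double sum. *)
Lemma ip_lincomb u v : ip P (lincomb u) (lincomb v) = (u *m S *m v^T) 0 0.
Proof.
case: yS => y2 _ cov _ _.
pose F (p q : 'I_N * 'I_m) w :=
  (u 0 (mxvec_index p.1 p.2) * v 0 (mxvec_index q.1 q.2)) * (y p.1 p.2 w * y q.1 q.2 w).
have yy p q : y p.1 p.2 \* y q.1 q.2 \in Lfun P 1 by apply: Lfun2_mul_Lfun1; exact: y2.
have F1 p q : F p q \in Lfun P 1.
  rewrite (_ : F p q = (u 0 (mxvec_index p.1 p.2) * v 0 (mxvec_index q.1 q.2))
     \o* (y p.1 p.2 \* y q.1 q.2)); first exact: Lfun_scale.
  by apply/funext => w; rewrite /F /= mulrC.
rewrite /ip; have -> : lincomb u * lincomb v = fun w => \sum_p \sum_q F p q w.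
  apply/funext => w; rewrite fctE /lincomb [X in X * _]pair_bigA [X in _ * X]pair_bigA mulr_suml.
  apply: eq_bigr => p _; rewrite mulr_sumr; apply: eq_bigr => q _.
  by rewrite /F mulrACA.
rewrite expectation_bigsum; last by move=> p; exact: Lfun1_sum.
have -> : (\sum_p expectation P (fun w => (\sum_q F p q w)%R))%E = (\sum_p \sum_q
   (u 0 (mxvec_index p.1 p.2) * v 0 (mxvec_index q.1 q.2) * blk S p.1 q.1 p.2 q.2))%:E.
  rewrite -sumEFin; apply: eq_bigr => p _; rewrite expectation_bigsum //.
  rewrite -sumEFin; apply: eq_bigr => q _.
  rewrite EFinM -cov -(expectationZl _ (yy p q)); congr expectation.
  by apply/funext => w; rewrite /F /= mulrC.
rewrite /= exchange_big [RHS]mxE sum_mxvec [RHS]pair_bigA; apply: eq_bigr => q _.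
rewrite !mxE sum_mxvec [in RHS]pair_bigA mulr_suml; apply: eq_bigr => p _ /=.
by rewrite /blk mulrAC.
Qed.

Lemma ZN_process_posdefmx : S \in unitmx -> posdefmx S.
Proof.
case: (yS) => _ _ _ /symmetricmxP sS _ uS.
apply: semiposdef_posdefmx => // v; rewrite -ip_lincomb /ip fine_ge0 //.
by apply: expectation_ge0 => w; rewrite fctE -expr2 sqr_ge0.
Qed.

(** These are the normal equations: [(u - p) *m S] lists the correlations of the residual with the
    scalar variables. *)
Lemma is_projP C u X : is_proj P y C (lincomb u) X <->
  exists p : 'rV[R]_(N * m), [/\ forall i, ~~ C (block_idx i) -> p 0 i = 0, X = lincomb p &
    forall i, C (block_idx i) -> ((u - p) *m S) 0 i = 0].
Proof.
have orthE p t a : ip P (lincomb u - lincomb p) (y t a) =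
    ((u - p) *m S) 0 (mxvec_index t a).
  by rewrite lincombB -lincomb_delta ip_lincomb trmx_delta -colE mxE.
split=> [[/in_spanP[p pC ->] orth]|[p [pC -> orth]]].
  exists p; split=> // i; case/mxvec_indexP: i => t a; rewrite block_idxE.
  by rewrite -orthE; exact: orth.
split; first by apply/in_spanP; exists p.
by move=> t a Ct; rewrite orthE orth // block_idxE.
Qed.

Lemma cond_orthP A C : S \in unitmx ->
  cond_orth P y A (fun s => ~~ A s) C <->
  (forall i j, A (block_idx i) -> ~~ C (block_idx i) ->
     ~~ A (block_idx j) -> ~~ C (block_idx j) -> invmx S i j = 0).
Proof.
move=> uS; case: (yS) => _ _ _ /symmetricmxP sS _.
have pK := posdefmx_inv sS (ZN_process_posdefmx uS).
have sK := trmx_invmx sS.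
pose bA : pred 'I_(N * m) := fun i => A (block_idx i).
pose bC : pred 'I_(N * m) := fun i => C (block_idx i).
have ipK x z : ip P (lincomb (x *m invmx S)) (lincomb (z *m invmx S)) =
    (x *m invmx S *m z^T) 0 0.
  by rewrite ip_lincomb mulmxKV // bilin_sym.
split=> [co|cross X Y pX pY].
  apply: (@orth_cross_zero _ _ _ bA bC sK pK) => x z xC zC xB zA.
  rewrite -ipK; set u := x *m _; set v := z *m _.
  (* As [u] vanishes off [A] and [C], [a - u] is supported on [C]; as [x] vanishes on [C], it is the
     projection of [a], with residual [u]. The same holds for [b] and [v], with [A] replaced by its
     complement. *)
  pose a := restr bA u; pose b := restr (predC bA) v.
  rewrite -[u](subKr a) -[v](subKr b) -(lincombB a) -(lincombB b).
  apply: (co); [apply/in_spanP; exists a | apply/in_spanP; exists b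
    | apply/is_projP; exists (a - u) | apply/is_projP; exists (b - v)] => //.
  - by move=> i Ai; rewrite mxE /bA (negbTE Ai).
  - by move=> i; rewrite negbK mxE /= /bA => ->.
  - split=> // i Ci; last by rewrite subKr mulmxKV // xC.
    rewrite mxE [a 0 i]mxE [(- u) 0 i]mxE; case: ifPn => Ai; first by rewrite subrr.
    by rewrite sub0r [u 0 i]xB ?oppr0.
  - split=> // i Ci; last by rewrite subKr mulmxKV // zC.
    rewrite mxE [b 0 i]mxE [(- v) 0 i]mxE /=; case: ifPn => Ai; first by rewrite subrr.
    by rewrite sub0r [v 0 i]zA ?oppr0 // -[bA i]negbK.
move=> /in_spanP[a aA ->] /in_spanP[b bB ->].
move=> /is_projP[p [pC -> po]] /is_projP[q [qC -> qo]].
(* Each residual is expressed through its correlation vector, [(a - p) *m S] or [(b - q) *m S]. *)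
rewrite !lincombB -[a - p](mulmxK uS) -[b - q](mulmxK uS) ipK.
apply: (@cross_zero_orth _ _ _ bA bC) => // i.
- by move=> Ai Ci; rewrite mulmxK // !mxE aA // pC // subrr.
- by move=> Ai Ci; rewrite mulmxK // !mxE bB ?negbK // qC // subrr.
Qed.

End Expectation.

(** * Block-circulant inverses and cyclic differences *)

Lemma invmx_invariant (F : fieldType) (k : nat) (M : 'M[F]_k) (f : 'I_k -> 'I_k) :
  injective f -> M \in unitmx -> (forall i j, M (f i) (f j) = M i j) ->
  forall i j, invmx M (f i) (f j) = invmx M i j.
Proof.
move=> injf uM Mf.
pose M' := \matrix_(i, j) invmx M (f i) (f j).
(* Uniqueness of the inverse: the relabelled inverse is still a left inverse of [M]. *)
suff M'E : M' *m M = 1%:M.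
  by move=> i j; rewrite -[invmx M in RHS](mul1mx) -M'E mulmxK // mxE.
apply/matrixP => i j; rewrite !mxE.
transitivity ((invmx M *m M) (f i) (f j)); last first.
  by rewrite mulVmx // mxE (inj_eq injf).
rewrite [RHS]mxE [RHS](reindex_inj injf); apply: eq_bigr => l _.
by rewrite mxE Mf.
Qed.

Lemma cdiffE (N : nat) (t s : 'I_N) :
  cdiff t s = (if s <= t then t - s else t + N - s)%N.
Proof.
have tN := ltn_ord t; have sN := ltn_ord s; rewrite /cdiff; case: leqP => st.
  by rewrite -(modn_small (m := t - s) (d := N)) -?(modnDr (t - s)); [congr modn|]; lia.
by rewrite modn_small; lia.
Qed.

Lemma cdiff_surj (N d : nat) (t : 'I_N) : (d < N)%N ->
  (exists s, cdiff s t = d) /\ (exists s, cdiff t s = d).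
Proof.
move=> dN; have tN := ltn_ord t; split.
- have [h|h] := ltnP (t + d) N.
    by exists (Ordinal h); rewrite cdiffE /=; case: leqP; lia.
  have h' : (t + d - N < N)%N by lia.
  by exists (Ordinal h'); rewrite cdiffE /=; case: leqP; lia.
- have [h|h] := leqP d t.
    have h' : (t - d < N)%N by lia.
    by exists (Ordinal h'); rewrite cdiffE /=; case: leqP; lia.
  have h' : (t + N - d < N)%N by lia.
  by exists (Ordinal h'); rewrite cdiffE /=; case: leqP; lia.
Qed.

(** Being block-circulant amounts to invariance under simultaneous cyclic shifts of both times,
    which passes to the inverse. *)
Lemma block_circulant_invmx (F : fieldType) (N m : nat) (M : 'M[F]_(N * m)) :
  M \in unitmx -> block_circulant M -> block_circulant (invmx M).
Proof.
(* For a successor size, ['I_N.+1] is the additive group of residues, where [cdiff] is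
   subtraction. *)
case: N M => [M _ _ []//|N M] uM cM t s t' s' tst's' a b.
pose shift r (i : 'I_(N.+1 * m)) : 'I_(N.+1 * m) :=
  let p := enum_val (cast_ord (esym (mxvec_cast N.+1 m)) i) in
  mxvec_index (p.1 + r) p.2.
have shiftE r (x : 'I_N.+1) (c : 'I_m) : shift r (mxvec_index x c) = mxvec_index (x + r) c.
  by rewrite /shift /mxvec_index !cast_ordK !enum_rankK.
have cE (x z : 'I_N.+1) : cdiff x z = x - z :> nat.
  by rewrite /= /cdiff modnDmr addnBA // ltnW.
have inj r : injective (shift r).
  apply: (can_inj (g := shift (- r))) => i; case/mxvec_indexP: i => x c.
  by rewrite !shiftE addrK.
(* Equal differences mean that the shift by [t' - t] takes [s] to [s'] as well. *)
have inv := invmx_invariant (inj (t' - t)) uM.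
rewrite /blk -inv.
  rewrite !shiftE; congr (invmx _ (mxvec_index _ _) (mxvec_index _ _)).
    by rewrite addrC subrK.
  have e : t - s = t' - s' by apply: val_inj; move: tst's'; rewrite !cE.
  by rewrite -(subrK s' t') -e [t - s + s' - t]addrAC [t - s - t]addrAC subrr add0r addNKr.
move=> i j; case/mxvec_indexP: i => x c; case/mxvec_indexP: j => z e.
rewrite !shiftE; apply: cM; rewrite !cE; congr nat_of_ord.
by rewrite opprD addrACA subrr addr0.
Qed.

(** Removes the modulus: with [cdiff_comp], positions on the circle become linear arithmetic up to
    one full turn. *)
Lemma cdiffP (N : nat) (t s : 'I_N) :
  (cdiff t s < N)%N /\ ((cdiff t s + s)%N = t \/ (cdiff t s + s)%N = (t + N)%N).
Proof. have := ltn_ord t; have := ltn_ord s; rewrite cdiffE; case: (leqP s t) => *; lia. Qed.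

Lemma cdiff_comp (N : nat) (t s r : 'I_N) :
  (cdiff t r + cdiff r s)%N = cdiff t s \/ (cdiff t r + cdiff r s)%N = (cdiff t s + N)%N.
Proof.
have [lt1 e1] := cdiffP t s; have [lt2 e2] := cdiffP t r; have [lt3 e3] := cdiffP r s.
lia.
Qed.

Lemma cdiffxx (N : nat) (t : 'I_N) : cdiff t t = 0%N.
Proof. by rewrite cdiffE leqnn subnn. Qed.

(** From [t], either way round, one must first leave the interval and then pass [n] boundary points
    before reaching [s]. *)
Lemma far_interval_exterior (N n : nat) (t1 t2 t s : 'I_N) : (1 <= n)%N ->
  cyc_interval t1 t2 t -> ~~ cyc_interval t1 t2 s -> ~~ cyc_boundary n t1 t2 s ->
  (n < minn (cdiff t s) (cdiff s t))%N.
Proof.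
rewrite /cyc_interval /cyc_boundary leq_min => n1 /andP[t_gt t_lt].
rewrite negb_and negb_or -!leqNgt => sI /andP[s1 s2].
have [lst _] := cdiffP s t; have [lss _] := cdiffP s t1; have [lts _] := cdiffP t s.
have [lt12 _] := cdiffP t2 t1; have [lst2 _] := cdiffP s t2; have [lt1s _] := cdiffP t1 s.
have e1 := cdiff_comp s t1 t; have e2 := cdiff_comp s t1 t2.
have e3 := cdiff_comp t1 t1 s; have e4 := cdiff_comp t t s.
rewrite !cdiffxx in e3 e4.
(* The case [s = t1] is impossible, since [n >= 1] puts [t1] in the boundary. *)
case/orP: sI => sI; lia.
Qed.

(** Take for [t1] and [t2] the predecessor and successor of [t]. They are distinct since [N >= 3],
    and the boundary consists of the times at distance 1 to [n] from [t]; it does not wrap round to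
    [t] because [2 * n < N]. *)
Lemma far_singleton_interval (N n : nat) (t s : 'I_N) :
  (1 <= n)%N -> (2 * n < N)%N -> (n < minn (cdiff t s) (cdiff s t))%N ->
  exists t1 t2 : 'I_N, [/\ cyc_interval t1 t2 t, ~~ cyc_boundary n t1 t2 t,
    ~~ cyc_interval t1 t2 s & ~~ cyc_boundary n t1 t2 s].
Proof.
rewrite leq_min => n1 nN /andP[far1 far2].
have [|_ [t1 t1E]] := @cdiff_surj N 1 t; first by lia.
have [|[t2 t2E] _] := @cdiff_surj N 1 t; first by lia.
exists t1, t2; rewrite /cyc_interval /cyc_boundary !negb_or -!leqNgt.
have [l1 _] := cdiffP t1 t; have [l2 _] := cdiffP t t2; have [l3 _] := cdiffP t2 t1.
have [l4 _] := cdiffP s t1; have [l5 _] := cdiffP t1 s; have [l6 _] := cdiffP s t2.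
have e1 := cdiff_comp t t t1; have e2 := cdiff_comp t t t2; have e3 := cdiff_comp t2 t1 t.
have e4 := cdiff_comp t t s; have e5 := cdiff_comp t1 s t.
have e6 := cdiff_comp s t1 t; have e7 := cdiff_comp s t2 t.
rewrite !cdiffxx in e1 e2 e4.
by split; lia.
Qed.

(** * The uniform probability on finitely many naturals *)

Section UniformNat.
Context {R : realType} (K : nat).

(** The atoms are [0] to [K], so there is always at least one. *)
Definition uniform_weight : {nonneg R} := ((K.+1%:R)^-1)%:nng.

Definition uniform_nat : set nat -> \bar R :=
  msum (fun i => mscale uniform_weight \d_i) K.+1.

HB.instance Definition _ := Measure.on uniform_nat.

Let uniform_nat_setT : uniform_nat [set: nat]%classic = 1%E.
Proof.
transitivity (\sum_(i < K.+1) (K.+1%:R^-1 : R)%:E)%E.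
  by apply: eq_bigr => i _; rewrite /= /mscale /= diracT mule1.
by rewrite sumEFin sumr_const card_ord -[X in X%:E]mulr_natr mulVf // pnatr_eq0.
Qed.

HB.instance Definition _ :=
  @Measure_isProbability.Build _ _ R uniform_nat uniform_nat_setT.

Lemma ge0_integral_uniform_nat (f : nat -> R) : (forall i, 0 <= f i) ->
  (\int[uniform_nat]_i (f i)%:E = (K.+1%:R^-1 * \sum_(i < K.+1) f i)%:E)%E.
Proof.
move=> f0; rewrite /uniform_nat ge0_integral_measure_sum //=; last by move=> i _; rewrite lee_fin.
rewrite mulr_sumr -sumEFin; apply: eq_bigr => i _.
rewrite ge0_integral_mscale //=; last by move=> j _; rewrite lee_fin.
by rewrite integral_dirac //= diracT mul1e.
Qed.

Lemma Lfun2_uniform_nat (f : nat -> R) : f \in Lfun uniform_nat 2%:E.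
Proof.
apply/andP; split; rewrite inE //=.
rewrite /finite_norm unlock poweR_lty //.
by rewrite ge0_integral_uniform_nat ?ltry // => i; rewrite powR_ge0.
Qed.

Lemma expectation_uniform_nat (f : nat -> R) :
  expectation uniform_nat f = (K.+1%:R^-1 * \sum_(i < K.+1) f i)%:E.
Proof.
have L1 g : g \in Lfun uniform_nat 1.
  have fin : uniform_nat [set: nat]%classic \is a fin_num.
    by rewrite uniform_nat_setT.
  exact: (Lfun_subset12 fin (Lfun2_uniform_nat g)).
have ge0E g : (forall i, 0 <= g i) ->
    expectation uniform_nat g = (K.+1%:R^-1 * \sum_(i < K.+1) g i)%:E.
  by move=> g0; rewrite unlock ge0_integral_uniform_nat.
(* Both terms are nonnegative, so [ge0E] applies to each. *)
have -> : f = (f \+ (fun i => `|f i|)) \- (fun i => `|f i|).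
  by apply/funext => i /=; rewrite addrK.
rewrite expectationB // !ge0E //= => [|i].
  by rewrite -EFinB -mulrBr -sumrB; congr (_ * _)%:E; apply: eq_bigr => i _.
by rewrite -lerBlDr sub0r lerNl -[leRHS]normrN ler_norm.
Qed.

End UniformNat.

(* A vector with covariance [L *m L^T] on the uniform space of [k + k] points:
   the [l]-th point of either half carries [Num.sqrt k] times the [l]-th column
   of [L], with opposite signs in the two halves so that the mean vanishes. *)
Lemma ZN_process_exists (R : realType) (N m : nat) (S : 'M[R]_(N * m)) :
  (0 < N * m)%N -> S^T = S -> posdefmx S -> block_circulant S ->
  exists (P : probability nat R) (y : 'I_N -> 'I_m -> nat -> R), ZN_process P y S.
Proof.
move=> k0 sS pS cS; have [L SE] := posdefmx_cholesky sS pS.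
pose k := (N * m)%N.
(* [uniform_nat] has one more atom than its parameter, hence the predecessor. *)
have k2 : (k + k).-1.+1 = (k + k)%N by rewrite prednK // addn_gt0 k0.
pose f (i : 'I_k) (j : nat) : R := if insub j is Some p then
  match fintype.split (p : 'I_(k + k)) with
  | inl l => Num.sqrt k%:R * L i l
  | inr l => - (Num.sqrt k%:R * L i l) end else 0.
have fl i l : f i (lshift k l) = Num.sqrt k%:R * L i l.
  by rewrite /f valK -[lshift k l]/(unsplit (inl l)) unsplitK.
have fr i l : f i (rshift k l) = - (Num.sqrt k%:R * L i l).
  by rewrite /f valK -[rshift k l]/(unsplit (inr l)) unsplitK.
exists (uniform_nat (k + k).-1), (fun t a => f (mxvec_index t a)); split=> //.
- by move=> t a; exact: Lfun2_uniform_nat.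
- move=> t a; rewrite expectation_uniform_nat k2 big_split_ord /=.
  under eq_bigr do rewrite fl; under [X in _ + X]eq_bigr do rewrite fr.
  by rewrite sumrN subrr mulr0.
- move=> t s a b; rewrite expectation_uniform_nat k2 big_split_ord /= /blk SE mxE.
  under eq_bigr do rewrite fctE !fl; under [X in _ + X]eq_bigr do rewrite fctE !fr mulrNN.
  rewrite -mulr2n -mulr_natl; congr EFin.
  have sk : Num.sqrt k%:R * Num.sqrt k%:R = k%:R :> R by rewrite -expr2 sqr_sqrtr.
  have kn0 : k%:R != 0 :> R by rewrite pnatr_eq0 -lt0n.
  under eq_bigr do rewrite mulrACA sk; rewrite -mulr_sumr natrD.
  under [in RHS]eq_bigr do rewrite mxE.
  by field; rewrite -mulr2n mulrn_eq0.
- exact/symmetricmxP.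
Qed.

(** * Bandedness and the characterization *)

Lemma cross_zero_banded (R : pzRingType) (N m n : nat) (K : 'M[R]_(N * m)) :
  (1 <= n)%N -> (2 * n < N)%N ->
  (forall t1 t2 : 'I_N, forall i j,
     cyc_interval t1 t2 (block_idx i) -> ~~ cyc_boundary n t1 t2 (block_idx i) ->
     ~~ cyc_interval t1 t2 (block_idx j) -> ~~ cyc_boundary n t1 t2 (block_idx j) ->
     K i j = 0) <-> banded n K.
Proof.
move=> n1 nN; split=> [cross t s far a b | bK t1 t2 i j].
  have [t1 [t2 [tI tC sI sC]]] := far_singleton_interval n1 nN far.
  by apply: (cross t1 t2); rewrite block_idxE.
case/mxvec_indexP: i => t a; case/mxvec_indexP: j => s b; rewrite !block_idxE.
by move=> tI _ sI sC; apply: bK; exact: far_interval_exterior n1 tI sI sC.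
Qed.

Theorem theorem3 (R : realType) (m n N : nat) (Sigma : 'M[R]_(N * m)) :
  (1 <= m)%N -> (1 <= n)%N -> (2 * n < N)%N -> Sigma \in unitmx ->
  ((exists (d : measure_display) (T : measurableType d) (P : probability T R)
           (y : 'I_N -> 'I_m -> T -> R),
       ZN_process P y Sigma /\ reciprocal P n y)
   <->
   [/\ invmx Sigma \is symmetricmx, posdefmx (invmx Sigma),
       block_circulant (invmx Sigma) & banded n (invmx Sigma)]).
Proof.
move=> m1 n1 nN uS.
(* This holds for every process with covariance [Sigma], so the converse only needs some such
   process to exist. *)
have reciprocalP d (T : measurableType d) (P : probability T R) y :
    ZN_process P y Sigma -> reciprocal P n y <-> banded n (invmx Sigma).
  move=> yS; rewrite -cross_zero_banded //.
  by split=> h t1 t2; apply/(cond_orthP yS _ _ uS); exact: h.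
split=> [[d [T [P [y [yS /(reciprocalP _ _ _ _ yS) bK]]]]] | [sK pK cK bK]].
  have [_ _ _ /symmetricmxP sS cS] := yS; split=> //.
  - exact/symmetricmxP/trmx_invmx.
  - exact: posdefmx_inv sS (ZN_process_posdefmx yS uS).
  - exact: block_circulant_invmx.
move/symmetricmxP in sK; have uK : invmx Sigma \in unitmx by rewrite unitmx_inv.
(* The conditions on [Sigma] follow because it is the inverse of [invmx Sigma]. *)
have [||||P [y yS]] := @ZN_process_exists R N m Sigma.
- by rewrite muln_gt0 m1 andbT; exact: leq_ltn_trans nN.
- by rewrite -[Sigma]invmxK trmx_invmx.
- by rewrite -[Sigma]invmxK; exact: posdefmx_inv.
- by rewrite -[Sigma]invmxK; exact: block_circulant_invmx.
by exists _, _, P, y; split=> //; apply/(reciprocalP _ _ _ _ yS).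
Qed.
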